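(* Assume that $L$ satisfies the generalized curvature-dimension inequality $\mathrm{CD}(\rho_1,\rho_2,\kappa,d)$ with $\rho_1>0$ (and $\rho_2>0$, $\kappa\ge0$, $0<d<\infty$). The first non-zero eigenvalue $\lambda_1$ of $-L$ satisfies $$\lambda_1\ge\frac{\rho_1\rho_2}{\frac{d-1}{d}\rho_2+\kappa}.$$
   Context: Setting. $\mathbb{M}$ is a connected finite-dimensional $C^\infty$ manifold endowed with a smooth measure $\mu$ and a second-order diffusion operator $L$ with smooth real coefficients, $L1=0$, which is locally subelliptic in the sense of Fefferman-Phong (each point has a neighborhood $U$ and constants $\varepsilon,c>0$ with $\|u\|_{H^\varepsilon}^2\le c\left(-\int uLu\,d\mu+\int u^2d\mu\right)$ for all $u\in C_0^\infty(U)$), and such that $\int_{\mathbb{M}} fLg\,d\mu=\int_{\mathbb{M}} gLf\,d\mu$ and $\int_{\mathbb{M}} fLf\,d\mu\le 0$ for all $f,g\in C_0^\infty(\mathbb{M})$ (smooth compactly supported functions). The carré du champ is $\Gamma(f,g)=\frac12(L(fg)-fLg-gLf)$, $\Gamma(f)=\Gamma(f,f)$. An absolutely continuous curve $\gamma:[0,T]\to\mathbb{M}$ is subunit for $L$ if $|\frac{d}{dt}f(\gamma(t))|\le\sqrt{\Gamma(f)(\gamma(t))}$ for every smooth $f$; its length is $T$. It is assumed that any two points are joined by a subunit curve; then the infimum $d(x,y)$ of the lengths of subunit curves from $x$ to $y$ is a distance, and $(\mathbb{M},d)$ is assumed complete. (The distance $d(\cdot,\cdot)$ is not to be confused with the constant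 $d$ below.) $\mathbb{M}$ is also endowed with a smooth symmetric bilinear differential form $\Gamma^Z$ on $C^\infty(\mathbb{M})$ satisfying $\Gamma^Z(fg,h)=f\Gamma^Z(g,h)+g\Gamma^Z(f,h)$ and $\Gamma^Z(f)=\Gamma^Z(f,f)\ge0$. Standing assumptions. (H.1) There is an increasing sequence $h_k\in C_0^\infty(\mathbb{M})$ with $h_k\nearrow1$ on $\mathbb{M}$ and $\|\Gamma(h_k)\|_\infty+\|\Gamma^Z(h_k)\|_\infty\to0$. (H.2) $\Gamma(f,\Gamma^Z(f))=\Gamma^Z(f,\Gamma(f))$ for all $f\in C^\infty(\mathbb{M})$. (H.3) For every $f\in C_0^\infty(\mathbb{M})$ and $T\ge0$, $\sup_{t\in[0,T]}\left(\|\Gamma(P_tf)\|_\infty+\|\Gamma^Z(P_tf)\|_\infty\right)<\infty$. Here $P_t=e^{tL}$ is the heat semigroup, defined by the spectral theorem from the self-adjoint extension of $L$ in $L^2(\mu)$ (unique under (H.1)). Curvature-dimension inequality. Put $\Gamma_2(f)=\frac12[L\Gamma(f)-2\Gamma(f,Lf)]$ and $\Gamma_2^Z(f)=\frac12[L\Gamma^Z(f)-2\Gamma^Z(f,Lf)]$. For $\rho_1\in\mathbb{R}$, $\rho_2>0$, $\kappa\ge0$, $0<d<\infty$, $L$ satisfies $\mathrm{CD}(\rho_1,\rho_2,\kappa,d)$ if for every $f\in C^\infty(\mathbb{M})$ and every $\nu>0$, $$\Gamma_2(f)+\nu\Gamma_2^Z(f)\ge\frac1d(Lf)^2+\left(\rho_1-\frac{\kappa}{\nu}\right)\Gamma(f)+\rho_2\Gamma^Z(f).$$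 It is known (Baudoin-Garofalo) that when $\rho_1>0$ the manifold $\mathbb{M}$ is compact and $\mu(\mathbb{M})<\infty$. *)

(* Defs.v *)
From HB Require Import structures.
From mathcomp Require Import all_boot all_order all_algebra.
From mathcomp Require Import all_classical all_reals all_analysis.

Set Implicit Arguments.
Unset Strict Implicit.
Unset Printing Implicit Defensive.

Import Order.TTheory GRing.Theory Num.Theory.
Import numFieldNormedType.Exports.

Local Open Scope classical_set_scope.
Local Open Scope ring_scope.

(* ---- Calculus on R^n ---------------------------------------------------- *)

Definition evec (R : realType) (n : nat) (j : 'I_n) : 'rV[R]_n := delta_mx 0 j.

Definition partial (R : realType) (n : nat) (j : 'I_n) (f : 'rV[R]_n -> R) :
  'rV[R]_n -> R := fun x => 'D_(evec R j) f x.

(* [O] is meant to be open: the derivatives are those of [f] on R^n, which at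
   a point of [O] only depend on the values of [f] on [O]. *)
Fixpoint Ck_on (R : realType) (n k : nat) (O : set 'rV[R]_n)
    (f : 'rV[R]_n -> R) : Prop :=
  (forall x, O x -> {for x, continuous f}) /\
  (if k is k'.+1 then
     forall j, (forall x, O x -> derivable f x (evec R j)) /\
               Ck_on k' O (partial j f)
   else True).

Definition smooth_on (R : realType) (n : nat) (O : set 'rV[R]_n)
    (f : 'rV[R]_n -> R) : Prop :=
  forall k, Ck_on k O f.

(* Integral against n-dimensional Lebesgue measure, as an iterated integral. *)
Fixpoint lebint (R : realType) (n : nat) : ('rV[R]_n -> \bar R) -> \bar R :=
  match n return ('rV[R]_n -> \bar R) -> \bar R with
  | 0%N => fun f => f 0
  | n'.+1 => fun f =>
      (\int[lebesgue_measure]_t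
         lebint (fun y : 'rV[R]_n' => f (row_mx (t%:M : 'rV[R]_1) y)))%E
  end.

Definition dotv (R : realType) (n : nat) (x y : 'rV[R]_n) : R :=
  \sum_j x 0 j * y 0 j.

(* |u^(xi)|^2 for the unnormalised Fourier transform of a real function [u];
   the normalisation only affects multiplicative constants below. *)
Definition fourier_sq (R : realType) (n : nat) (u : 'rV[R]_n -> R)
    (xi : 'rV[R]_n) : R :=
  fine (lebint (fun x => (u x * cos (dotv x xi))%:E)) ^+ 2 +
  fine (lebint (fun x => (u x * sin (dotv x xi))%:E)) ^+ 2.

Definition sobolev_normsq (R : realType) (n : nat) (eps : R)
    (u : 'rV[R]_n -> R) : \bar R :=
  lebint (fun xi => ((1 + dotv xi xi) `^ eps * fourier_sq u xi)%:E).

(* ---- Smooth manifolds --------------------------------------------------- *)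

(* [chart_inv i] is only meaningful on the open set [chart i @` chart_dom i]. *)
Record atlas (R : realType) (M : ptopologicalType) (n : nat) := Atlas {
  chart_index : Type;
  chart_dom : chart_index -> set M;
  chart : chart_index -> M -> 'rV[R]_n;
  chart_inv : chart_index -> 'rV[R]_n -> M;
  chart_dom_open : forall i, open (chart_dom i);
  chart_cover : forall x, exists i, chart_dom i x;
  chart_img_open : forall i, open (chart i @` chart_dom i);
  chartK : forall i x, chart_dom i x -> chart_inv i (chart i x) = x;
  chart_continuous : forall i x, chart_dom i x -> {for x, continuous (chart i)};
  chart_inv_continuous : forall i y,
    (chart i @` chart_dom i) y -> {for y, continuous (chart_inv i)};
  chart_transition : forall i j (k : 'I_n),
    smooth_on (chart i @` (chart_dom i `&` chart_dom j))
              (fun y => chart j (chart_inv i y) 0 k) }.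

Definition chart_img (R : realType) (M : ptopologicalType) (n : nat)
    (A : atlas R M n) (i : chart_index A) : set 'rV[R]_n :=
  chart i @` chart_dom i.

Definition connected_manifold_topology (M : ptopologicalType) : Prop :=
  [/\ hausdorff_space M, @second_countable M & connected [set: M]].

Definition smooth (R : realType) (M : ptopologicalType) (n : nat)
    (A : atlas R M n) (f : M -> R) : Prop :=
  forall i : chart_index A, smooth_on (chart_img i) (f \o chart_inv i).

Definition support_of (R : realType) (M : ptopologicalType) (f : M -> R) :
  set M := closure [set x | f x != 0].

Definition smooth_c (R : realType) (M : ptopologicalType) (n : nat)
    (A : atlas R M n) (f : M -> R) : Prop :=
  smooth A f /\ compact (support_of f).

Definition borel (M : ptopologicalType) := g_sigma_algebraType (@open M).

(* A smooth positive density with respect to Lebesgue measure in each chart. *)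
Definition smooth_measure (R : realType) (M : ptopologicalType) (n : nat)
    (A : atlas R M n) (mu : {measure set (borel M) -> \bar R}) : Prop :=
  forall i : chart_index A, exists rho : 'rV[R]_n -> R,
    [/\ smooth_on (chart_img i) rho,
        forall y, chart_img i y -> 0 < rho y
      & forall B : set (borel M), measurable B -> B `<=` chart_dom i ->
          mu B = lebint (fun y => (rho y * \1_(chart i @` B) y)%:E)].

Definition integral_of (R : realType) (M : ptopologicalType)
    (mu : {measure set (borel M) -> \bar R}) (f : M -> R) : R :=
  Rintegral mu [set: borel M] f.

Definition supnorm (R : realType) (M : Type) (f : M -> R) : \bar R :=
  ereal_sup (range (fun x => (`|f x|)%:E)).

(* ---- Diffusion operators and associated forms --------------------------- *)

(* Operators and forms are total functions on [M -> R]; every requirement on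
   them only concerns smooth arguments. *)

Definition diffusion_operator (R : realType) (M : ptopologicalType) (n : nat)
    (A : atlas R M n) (L : (M -> R) -> (M -> R)) : Prop :=
  forall i : chart_index A,
  exists (a : 'I_n -> 'I_n -> 'rV[R]_n -> R) (b : 'I_n -> 'rV[R]_n -> R)
         (c : 'rV[R]_n -> R),
    [/\ (forall j k, smooth_on (chart_img i) (a j k)) /\
        (forall j, smooth_on (chart_img i) (b j)) /\
        smooth_on (chart_img i) c,
        forall j k y, chart_img i y -> a j k y = a k j y,
        forall y (xi : 'rV[R]_n), chart_img i y ->
          0 <= \sum_j \sum_k a j k y * xi 0 j * xi 0 k
      & forall f x, smooth A f -> chart_dom i x ->
          let F := f \o chart_inv i in
          let y := chart i x in
          L f x = \sum_j \sum_k a j k y * partial j (partial k F) y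
                  + \sum_j b j y * partial j F y + c y * F y].

Definition symmetric_operator (R : realType) (M : ptopologicalType) (n : nat)
    (A : atlas R M n) (mu : {measure set (borel M) -> \bar R})
    (L : (M -> R) -> (M -> R)) : Prop :=
  forall f g, smooth_c A f -> smooth_c A g ->
    integral_of mu (f \* L g) = integral_of mu (g \* L f).

Definition nonpositive_operator (R : realType) (M : ptopologicalType) (n : nat)
    (A : atlas R M n) (mu : {measure set (borel M) -> \bar R})
    (L : (M -> R) -> (M -> R)) : Prop :=
  forall f, smooth_c A f -> integral_of mu (f \* L f) <= 0.

(* Fefferman-Phong; the H^eps norm is taken in a chart whose domain contains
   the neighbourhood [U], after extending by 0 the function read in it. *)
Definition locally_subelliptic (R : realType) (M : ptopologicalType) (n : nat)
    (A : atlas R M n) (mu : {measure set (borel M) -> \bar R})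
    (L : (M -> R) -> (M -> R)) : Prop :=
  forall x : M, exists (i : chart_index A) (U : set M) (eps c : R),
    [/\ open U, U x, U `<=` chart_dom i, 0 < eps /\ 0 < c
      & forall u, smooth_c A u -> support_of u `<=` U ->
        (sobolev_normsq eps (patch (fun=> 0%R) (chart_img i) (u \o chart_inv i))
         <= (c * (- integral_of mu (u \* L u) + integral_of mu (u \* u)))%:E)%E].

Definition carre (R : realType) (M : Type) (L : (M -> R) -> (M -> R))
    (f g : M -> R) : M -> R :=
  fun x => 2^-1 * (L (f \* g) x - f x * L g x - g x * L f x).

Record vertical_form (R : realType) (M : ptopologicalType) (n : nat)
    (A : atlas R M n) (G : (M -> R) -> (M -> R) -> (M -> R)) : Prop :=
  VerticalForm {
  vform_smooth : forall f g, smooth A f -> smooth A g -> smooth A (G f g);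
  vform_sym : forall f g, smooth A f -> smooth A g -> G f g = G g f;
  vform_linear : forall (s : R) f g h,
    smooth A f -> smooth A g -> smooth A h ->
    forall x, G (fun y => s * f y + g y) h x = s * G f h x + G g h x;
  vform_leibniz : forall f g h, smooth A f -> smooth A g -> smooth A h ->
    forall x, G (f \* g) h x = f x * G g h x + g x * G f h x;
  vform_ge0 : forall f, smooth A f -> forall x, 0 <= G f f x }.

(* Gamma_2 for [G := carre L] and Gamma_2^Z for [G := GammaZ]. *)
Definition iterated_form (R : realType) (M : Type) (L : (M -> R) -> (M -> R))
    (G : (M -> R) -> (M -> R) -> (M -> R)) (f : M -> R) : M -> R :=
  fun x => 2^-1 * (L (G f f) x - 2 * G f (L f) x).

Definition CD (R : realType) (M : ptopologicalType) (n : nat)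
    (A : atlas R M n) (L : (M -> R) -> (M -> R))
    (GZ : (M -> R) -> (M -> R) -> (M -> R)) (rho1 rho2 kappa d : R) : Prop :=
  forall f, smooth A f -> forall nu : R, 0 < nu -> forall x,
    d^-1 * L f x ^+ 2 + (rho1 - kappa / nu) * carre L f f x + rho2 * GZ f f x
    <= iterated_form L (carre L) f x + nu * iterated_form L GZ f x.

(* ---- Subunit curves and the associated distance ------------------------- *)

Definition abs_continuous_on (R : realType) (a b : R) (f : R -> R) : Prop :=
  forall e : R, 0 < e -> exists2 del : R, 0 < del &
    forall s : seq (R * R),
      all (fun p => [&& a <= p.1, p.1 <= p.2 & p.2 <= b]) s ->
      pairwise (fun p q => (p.2 <= q.1) || (q.2 <= p.1)) s ->
      \sum_(p <- s) (p.2 - p.1) < del ->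
      \sum_(p <- s) `|f p.2 - f p.1| < e.

(* For each smooth [f], the derivative of [f \o gam] exists almost everywhere
   only, and so does the bound on it. *)
Definition subunit_curve (R : realType) (M : ptopologicalType) (n : nat)
    (A : atlas R M n) (L : (M -> R) -> (M -> R)) (T : R) (gam : R -> M) : Prop :=
  [/\ 0 <= T, {within `[0, T], continuous gam}
    & forall f, smooth A f ->
        abs_continuous_on 0 T (f \o gam) /\
        {ae lebesgue_measure, forall t : R, t \in `]0, T[ ->
           derivable (f \o gam) t 1 /\
           `|derive1 (f \o gam) t| <= Num.sqrt (carre L f f (gam t))}].

Definition subunit_lengths (R : realType) (M : ptopologicalType) (n : nat)
    (A : atlas R M n) (L : (M -> R) -> (M -> R)) (x y : M) : set R :=
  [set T | exists gam, [/\ subunit_curve A L T gam, gam 0 = x & gam T = y]].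

Definition subunit_connected (R : realType) (M : ptopologicalType) (n : nat)
    (A : atlas R M n) (L : (M -> R) -> (M -> R)) : Prop :=
  forall x y, subunit_lengths A L x y !=set0.

Definition subunit_dist (R : realType) (M : ptopologicalType) (n : nat)
    (A : atlas R M n) (L : (M -> R) -> (M -> R)) (x y : M) : R :=
  inf (subunit_lengths A L x y).

Definition subunit_complete (R : realType) (M : ptopologicalType) (n : nat)
    (A : atlas R M n) (L : (M -> R) -> (M -> R)) : Prop :=
  forall u : nat -> M,
    (forall e : R, 0 < e -> exists N, forall p q, (N <= p)%N -> (N <= q)%N ->
       subunit_dist A L (u p) (u q) < e) ->
    exists x, (fun p => subunit_dist A L (u p) x) @ \oo --> (0 : R).

(* ---- Heat semigroup ----------------------------------------------------- *)

Definition L2 (R : realType) (M : ptopologicalType)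
    (mu : {measure set (borel M) -> \bar R}) (f : M -> R) : Prop :=
  (f : borel M -> R) \in Lfun mu 2%:E.

Definition ip (R : realType) (M : ptopologicalType)
    (mu : {measure set (borel M) -> \bar R}) (f g : M -> R) : R :=
  integral_of mu (f \* g).

(* A projection-valued measure [E] on the Borel sets of R, acting on L^2(mu)
   (functions up to a.e. equality), with [m f] the scalar measure
   B |-> <E(B) f, f>; countable additivity of [E] is that of the [m f]. *)
Record spectral_measure (R : realType) (M : ptopologicalType)
    (mu : {measure set (borel M) -> \bar R})
    (E : set (measurableTypeR R) -> (M -> R) -> (M -> R))
    (m : (M -> R) -> {measure set (measurableTypeR R) -> \bar R}) : Prop :=
  SpectralMeasure {
  spm_L2 : forall B f, measurable B -> L2 mu f -> L2 mu (E B f);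
  spm_linear : forall B (s : R) f g, measurable B -> L2 mu f -> L2 mu g ->
    {ae mu, forall x : borel M,
       E B (fun y => s * f y + g y) x = s * E B f x + E B g x};
  spm_sym : forall B f g, measurable B -> L2 mu f -> L2 mu g ->
    ip mu (E B f) g = ip mu f (E B g);
  spm_mul : forall B C f, measurable B -> measurable C -> L2 mu f ->
    {ae mu, forall x : borel M, E (B `&` C) f x = E B (E C f) x};
  spm_setT : forall f, L2 mu f ->
    {ae mu, forall x : borel M, E [set: measurableTypeR R] f x = f x};
  spm_scalar : forall B f, measurable B -> L2 mu f ->
    m f B = (ip mu (E B f) f)%:E }.

(* [f] is in the domain of phi(S) and phi(S) f = g, where S = \int l dE(l):
   <g, h> = \int phi(l) d<E(l) f, h> for all [h] in the domain of phi(S), the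
   signed measure <E f, h> being (m (f + h) - m (f - h)) / 4. *)
Definition functional_calculus (R : realType) (M : ptopologicalType)
    (mu : {measure set (borel M) -> \bar R})
    (m : (M -> R) -> {measure set (measurableTypeR R) -> \bar R})
    (phi : R -> R) (f g : M -> R) : Prop :=
  let dom h := L2 mu h /\
    (\int[m h]_(l in [set: measurableTypeR R]) (phi l ^+ 2)%:E < +oo)%E in
  [/\ dom f, L2 mu g
    & forall h, dom h ->
        ip mu g h =
          4^-1 * (Rintegral (m (f \+ h)) [set: measurableTypeR R] phi
                  - Rintegral (m (f \- h)) [set: measurableTypeR R] phi)].

(* [P t] = e^{t S}, where S is a self-adjoint extension of [L] on compactly
   supported smooth functions, given by its spectral resolution. *)
Definition heat_semigroup (R : realType) (M : ptopologicalType) (n : nat)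
    (A : atlas R M n) (mu : {measure set (borel M) -> \bar R})
    (L : (M -> R) -> (M -> R)) (P : R -> (M -> R) -> (M -> R)) : Prop :=
  exists E m,
    [/\ spectral_measure mu E m,
        forall u, smooth_c A u -> functional_calculus mu m id u (L u)
      & forall (t : R) f, 0 <= t -> L2 mu f ->
          functional_calculus mu m (fun l => expR (t * l)) f (P t f)].

(* ---- Standing assumptions ----------------------------------------------- *)

Definition H1 (R : realType) (M : ptopologicalType) (n : nat)
    (A : atlas R M n) (L : (M -> R) -> (M -> R))
    (GZ : (M -> R) -> (M -> R) -> (M -> R)) : Prop :=
  exists h : nat -> M -> R,
    [/\ forall k, smooth_c A (h k),
        forall k x, h k x <= h k.+1 x,
        forall x, (fun k => h k x) @ \oo --> (1 : R)
      & ((fun k => supnorm (carre L (h k) (h k)) + supnorm (GZ (h k) (h k)))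
           @ \oo --> 0)%E].

Definition H2 (R : realType) (M : ptopologicalType) (n : nat)
    (A : atlas R M n) (L : (M -> R) -> (M -> R))
    (GZ : (M -> R) -> (M -> R) -> (M -> R)) : Prop :=
  forall f, smooth A f ->
    forall x, carre L f (GZ f f) x = GZ f (carre L f f) x.

(* The pointwise expressions refer to the smooth representative of the L^2
   class of P_t f. *)
Definition H3 (R : realType) (M : ptopologicalType) (n : nat)
    (A : atlas R M n) (L : (M -> R) -> (M -> R))
    (GZ : (M -> R) -> (M -> R) -> (M -> R))
    (P : R -> (M -> R) -> (M -> R)) : Prop :=
  forall f (T : R), smooth_c A f -> 0 <= T ->
    (forall t, 0 <= t <= T -> smooth A (P t f)) /\
    (ereal_sup [set (supnorm (carre L (P t f) (P t f))
                     + supnorm (GZ (P t f) (P t f)))%E | t in [set t : R | (0 <= t <= T)%R]]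
     < +oo)%E.

(* ---- Eigenvalues of -L -------------------------------------------------- *)

(* [L] is hypoelliptic, so that on a compact manifold the eigenfunctions of its
   self-adjoint extension in L^2 are smooth. *)
Definition eigenvalue_opp (R : realType) (M : ptopologicalType) (n : nat)
    (A : atlas R M n) (L : (M -> R) -> (M -> R)) (lam : R) : Prop :=
  exists f, [/\ smooth A f, exists x, f x != 0 & forall x, - L f x = lam * f x].

Definition first_nonzero_eigenvalue_opp (R : realType) (M : ptopologicalType)
    (n : nat) (A : atlas R M n) (L : (M -> R) -> (M -> R)) (lam1 : R) : Prop :=
  [/\ eigenvalue_opp A L lam1, lam1 != 0
    & forall lam, eigenvalue_opp A L lam -> lam != 0 -> lam1 <= lam].

(* Main.v *)
Require Import Defs.
From HB Require Import structures.
From mathcomp Require Import all_boot all_order all_algebra.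
From mathcomp Require Import all_classical all_reals all_analysis.
From mathcomp Require Import ring.
Import Order.TTheory GRing.Theory Num.Theory.
Import numFieldNormedType.Exports.
Local Open Scope classical_set_scope.
Local Open Scope ring_scope.

(* Let [- L f = lam1 f] with [f <> 0]. Integrating the curvature-dimension
   inequality of [f] over the compact [M] and using the symmetry of [L] gives,
   with F = int f^2 and Z = int Gamma^Z(f),
     lam1^2 F / d + (rho1 - kappa / nu) lam1 F + rho2 Z
       <= lam1^2 F + nu lam1 Z.
   Here [lam1 > 0], so that [nu = rho2 / lam1] is allowed; it cancels Z, and
   dividing by [lam1 F > 0] yields the bound. *)

(** * Closure properties of smooth functions on an open subset of R^n *)

Lemma near_eq_cvg_at {T U : topologicalType} (f g : T -> U) (x : T) (l : U) :
  (\near x, f x = g x) -> f @ x --> l -> g @ x --> l.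
Proof. by move=> fg; apply: cvg_trans; exact: near_eq_cvg. Qed.

Section SmoothOn.
Context {R : realType} {n : nat} {O : set 'rV[R]_n}.
Implicit Types f g : 'rV[R]_n -> R.

Lemma Ck_onW k f : Ck_on k.+1 O f -> Ck_on k O f.
Proof.
elim: k f => [|k IH] f [cf Df]; first by split.
by split=> // j; have [df /IH] := Df j.
Qed.

Hypothesis oO : open O.

(** Since [O] is open, equality on [O] is equality near each of its points, and this is all that
    continuity and derivatives depend on. It lets the sum and product rules, available only at
    points of [O], be used under [Ck_on]. *)
Lemma eq_Ck_on k f g : {in O, f =1 g} -> Ck_on k O f -> Ck_on k O g.
Proof.
have nearE f' g' : {in O, f' =1 g'} -> forall x, O x -> \near x, f' x = g' x.
  move=> e x Ox; have : \near x, O x by exact: open_nbhs_nbhs.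
  by apply: filterS => y Oy; apply: e; exact/mem_set.
elim: k f g => [|k IH] f g efg [cf Df]; split=> //.
1,2: move=> x Ox; suff: g y @[y --> x] --> f x by rewrite (efg x (mem_set Ox)).
1,2: by apply: near_eq_cvg_at (cf x Ox); exact: nearE.
move=> j; have [df CDf] := Df j; split.
  move=> x Ox; exact: near_eq_derivable (nearE _ _ efg x Ox) (df x Ox).
apply: IH CDf => x /set_mem Ox; apply: near_eq_derive; exact: nearE.
Qed.

Lemma Ck_on_cst k (c : R) : Ck_on k O (fun=> c).
Proof.
elim: k c => [|k IH] c; split=> //; try by move=> x _; exact: cst_continuous.
move=> j; split; first by move=> x _; exact: derivable_cst.
have -> : partial j (fun=> c) = fun=> 0; last exact: IH.
by apply/funext => x; exact: derive_cst.
Qed.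

Lemma Ck_onD k f g : Ck_on k O f -> Ck_on k O g ->
  Ck_on k O (fun x => f x + g x).
Proof.
elim: k f g => [|k IH] f g [cf Df] [cg Dg].
  by split=> // x Ox; exact: (cvgD (cf x Ox) (cg x Ox)).
split=> [x Ox|j]; first exact: (cvgD (cf x Ox) (cg x Ox)).
have [df CDf] := Df j; have [dg CDg] := Dg j; split=> [x Ox|].
  exact: (derivableD (df x Ox) (dg x Ox)).
apply: eq_Ck_on (IH _ _ CDf CDg) => x /set_mem Ox.
by rewrite /partial -deriveD //; [exact: df|exact: dg].
Qed.

(** By the Leibniz rule a partial derivative of the product is a sum of products to which the
    induction applies, once [Ck_onW] has lowered the order of the undifferentiated factor by one. *)
Lemma Ck_onM k f g : Ck_on k O f -> Ck_on k O g ->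
  Ck_on k O (fun x => f x * g x).
Proof.
elim: k f g => [|k IH] f g Cf Cg.
  have [cf _] := Cf; have [cg _] := Cg.
  by split=> // x Ox; exact: (cvgM (cf x Ox) (cg x Ox)).
have [cf Df] := Cf; have [cg Dg] := Cg.
split=> [x Ox|j]; first exact: (cvgM (cf x Ox) (cg x Ox)).
have [df CDf] := Df j; have [dg CDg] := Dg j; split=> [x Ox|].
  exact: (derivableM (df x Ox) (dg x Ox)).
apply: (eq_Ck_on _ _ _ _ (Ck_onD _ _ _ (IH _ _ (Ck_onW _ _ Cf) CDg)
                            (IH _ _ (Ck_onW _ _ Cg) CDf))) => x /set_mem Ox.
by rewrite /partial [RHS](@deriveM _ _ f g) //; [exact: df|exact: dg].
Qed.

Lemma smooth_on_eq f g : {in O, f =1 g} -> smooth_on O f -> smooth_on O g.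
Proof. by move=> e Sf k; exact: eq_Ck_on e (Sf k). Qed.

Lemma smooth_on_cst (c : R) : smooth_on O (fun=> c).
Proof. by move=> k; exact: Ck_on_cst. Qed.

Lemma smooth_onD f g : smooth_on O f -> smooth_on O g ->
  smooth_on O (fun x => f x + g x).
Proof. by move=> Sf Sg k; exact: Ck_onD. Qed.

Lemma smooth_onM f g : smooth_on O f -> smooth_on O g ->
  smooth_on O (fun x => f x * g x).
Proof. by move=> Sf Sg k; exact: Ck_onM. Qed.

Lemma smooth_on_sum (I : finType) (F : I -> 'rV[R]_n -> R) :
  (forall i, smooth_on O (F i)) -> smooth_on O (fun x => \sum_i F i x).
Proof.
move=> SF; elim: (index_enum I) => [|i s IH].
  by under eq_fun do rewrite big_nil; exact: smooth_on_cst.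
by under eq_fun do rewrite big_cons; exact: smooth_onD.
Qed.

Lemma smooth_on_partial j f : smooth_on O f -> smooth_on O (partial j f).
Proof. by move=> Sf k; have [_ /(_ j)[]] := Sf k.+1. Qed.

End SmoothOn.

(** * Smooth functions on the manifold and the action of [L] and [carre L] on them *)

Section Smooth.
Context {R : realType} {M : ptopologicalType} {n : nat} {A : atlas R M n}.
Implicit Types f g : M -> R.

Lemma smooth_cst (c : R) : smooth A (fun=> c).
Proof. by move=> i; apply: smooth_on_cst; exact: chart_img_open. Qed.

Lemma smoothD f g : smooth A f -> smooth A g -> smooth A (fun x => f x + g x).
Proof.
by move=> Sf Sg i; apply: (smooth_onD _ _ _ (Sf i) (Sg i)); exact: chart_img_open.
Qed.

Lemma smoothM f g : smooth A f -> smooth A g -> smooth A (f \* g).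
Proof.
by move=> Sf Sg i; apply: (smooth_onM _ _ _ (Sf i) (Sg i)); exact: chart_img_open.
Qed.

Lemma smoothZ (c : R) f : smooth A f -> smooth A (fun x => c * f x).
Proof. by move=> Sf; exact: (smoothM (fun=> c) f (smooth_cst c) Sf). Qed.

(** Near [x] the function is its chart expression composed with the chart, and both are
    continuous. *)
Lemma smooth_continuous f : smooth A f -> continuous f.
Proof.
move=> Sf x; have [i ix] := chart_cover A x.
have oi : chart_img i (chart i x) by exists x.
have [cf _] := Sf i 0%N.
have : (f \o chart_inv i) \o chart i @ x --> f x.
  rewrite -{2}(chartK ix).
  exact: (cvg_comp _ _ (chart_continuous ix) (cf _ oi)).
apply: near_eq_cvg_at.
have : \near x, chart_dom i x by apply: open_nbhs_nbhs; split=> //; exact: chart_dom_open.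
by apply: filterS => y iy /=; rewrite chartK.
Qed.

(** On the open image of a chart, [L f] coincides with the local expression [G], built from smooth
    coefficients and partial derivatives of [F]. *)
Lemma smooth_diffusion L f :
  diffusion_operator A L -> smooth A f -> smooth A (L f).
Proof.
move=> LA Sf i; have [a [b [c [[Sa [Sb Sc]] _ _ LE]]]] := LA i.
have oi : open (chart_img i) by exact: chart_img_open.
pose F := f \o chart_inv i.
pose G y := \sum_j \sum_k a j k y * partial j (partial k F) y
            + \sum_j b j y * partial j F y + c y * F y.
apply: (smooth_on_eq oi G).
  by move=> _ /set_mem[x ix <-]; rewrite /= (chartK ix) LE.
apply: (smooth_onD oi); last exact: (smooth_onM oi _ _ Sc (Sf i)).
apply: (smooth_onD oi); apply: (smooth_on_sum oi) => j; last first.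
  by apply: (smooth_onM oi) => //; apply: smooth_on_partial; exact: Sf.
apply: (smooth_on_sum oi) => k; apply: (smooth_onM oi) => //.
by do 2 apply: smooth_on_partial; exact: Sf.
Qed.

Lemma smooth_carre L f g : diffusion_operator A L ->
  smooth A f -> smooth A g -> smooth A (carre L f g).
Proof.
move=> LA Sf Sg; have SL h := smooth_diffusion L h LA.
have -> : carre L f g = fun x => 2^-1 * (L (f \* g) x +
    ((-1) * (f \* L g) x + (-1) * (g \* L f) x)).
  by apply/funext => x; rewrite /carre !mulN1r addrA.
apply: smoothZ; apply: smoothD; first exact/SL/smoothM.
by apply: smoothD; apply: smoothZ; apply: smoothM => //; exact: SL.
Qed.

End Smooth.

(** * Lower bounds for the iterated Lebesgue integral *)

Section Lebint.
Context {R : realType}.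
Local Open Scope ereal_scope.

(* Unlike [ge0_le_integral], no measurability is required: the integral of a
   nonnegative function is a supremum over the simple functions below it. *)
Lemma le_integralT_ge0 d (T : measurableType d)
    (mu : {measure set T -> \bar R}) (f g : T -> \bar R) :
  (forall x, 0 <= f x) -> (forall x, f x <= g x) ->
  \int[mu]_x f x <= \int[mu]_x g x.
Proof.
move=> f0 fg; rewrite !ge0_integralTE//; last first.
  by move=> x; exact: le_trans (f0 x) (fg x).
apply: le_ereal_sup => _ [h /= hf <-]; exists h => //= x.
exact: le_trans (hf x) (fg x).
Qed.

Lemma lebint_ge0 n (f : 'rV[R]_n -> \bar R) :
  (forall x, 0 <= f x) -> 0 <= lebint f.
Proof.
elim: n f => [|n IH] f f0 /=; first exact: f0.
by apply: integral_ge0 => t _; exact: IH.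
Qed.

(** Induction on the dimension: the inner integral is at least [c * r ^+ n] when the first
    coordinate lies in an interval of length [r], and is nonnegative otherwise. *)
Lemma lebint_ge_box n (f : 'rV[R]_n -> \bar R) (a : 'rV[R]_n) (r c : R) :
  (0 < r)%R -> (0 <= c)%R -> (forall x, 0 <= f x) ->
  (forall x : 'rV[R]_n, (forall j, a 0 j < x 0 j < a 0 j + r)%R -> c%:E <= f x) ->
  (c * r ^+ n)%:E <= lebint f.
Proof.
move=> r0 c0; elim: n f a => [|n IH] f a f0 fc /=.
  by rewrite expr0 mulr1; apply: fc => -[].
pose I : set R := `]a ord0 ord0, (a ord0 ord0 + r)%R[%classic.
have mI : measurable (I : set (measurableTypeR R)) by exact: measurable_itv.
have lI : lebesgue_measure I = r%:E.
  by rewrite lebesgue_measure_itv/= lte_fin ltrDl r0 -EFinB addrAC subrr add0r.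
have -> : (c * r ^+ n.+1)%:E =
    \int[lebesgue_measure]_t ((fun=> (c * r ^+ n)%:E) \_ I) t.
  rewrite -integral_mkcond (integral_cst lebesgue_measure mI).
  by rewrite [X in _ * X]lI exprSr mulrA EFinM.
have cr0 : (0 <= c * r ^+ n)%R by rewrite mulr_ge0// exprn_ge0// ltW.
apply: le_integralT_ge0 => t.
  by rewrite /patch; case: ifP => // _; rewrite lee_fin.
rewrite /patch; case: ifPn => [/set_mem It|_]; last exact: lebint_ge0.
(* [rsubmx a] is the corner of the remaining box, with the first coordinate dropped. *)
apply: (IH _ (@rsubmx R 1 1 n a)) => // x xa; apply: fc => j.
pose z : 'rV[R]_n.+1 := row_mx (t%:M : 'rV_1) x; rewrite -/z.
have [k ->|k ->] := @split_ordP 1 n j.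
  have -> : z 0%R (lshift n k) = t.
    by rewrite [LHS]row_mxEl mxE (ord1 k) eqxx mulr1n.
  rewrite (ord1 k) (_ : lshift n 0%R = ord0); last exact/val_inj.
  by move: It; rewrite /I/= in_itv.
have -> : z 0%R (rshift 1 k) = x 0%R k by rewrite [LHS]row_mxEr.
by have := xa k; rewrite mxE.
Qed.

(** Balls are taken for the sup norm, so the ball of radius [e] about [y] is an open cube, with
    corner [y - const_mx e] and side [e *+ 2]. *)
Lemma lebint_gt0 n (f : 'rV[R]_n -> \bar R) (y : 'rV[R]_n) (c : R) :
  (0 < c)%R -> (forall x, 0 <= f x) -> (\near y, c%:E <= f y) -> 0 < lebint f.
Proof.
move=> c0 f0 /nbhs_ballP[e /= e0 ef].
apply: lt_le_trans (@lebint_ge_box n f (y - const_mx e) (e *+ 2) c _ _ f0 _).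
- by rewrite lte_fin mulr_gt0// exprn_gt0// pmulrn_lgt0.
- by rewrite pmulrn_lgt0.
- exact: ltW.
- move=> x xy; apply: ef; split=> // i j; rewrite (ord1 i) /ball/= distrC ltr_distl.
  by have := xy j; rewrite !mxE mulr2n addrA subrK.
Qed.

End Lebint.

(** * Positivity of [mu] on open sets and integrability of continuous functions *)

Section Measure.
Context {R : realType} {M : ptopologicalType} {n : nat} {A : atlas R M n}
  {mu : {measure set (borel M) -> \bar R}}.

Lemma open_borel (U : set M) : open U -> measurable (U : set (borel M)).
Proof. exact: sub_sigma_algebra. Qed.

(** It suffices to measure the part of [U] inside one chart domain around [x]; there the density
    stays above half of its positive value at the image of [x]. *)
Lemma smooth_measure_gt0 (U : set (borel M)) (x : M) :
  smooth_measure A mu -> open (U : set M) -> U x -> (0 < mu U)%E.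
Proof.
move=> muA oU Ux; have [i ix] := chart_cover A x.
have [rho [Srho rho0 muE]] := muA i.
have iy : chart_img i (chart i x) by exists x.
pose B : set (borel M) := U `&` chart_dom i.
have oB : open (B : set M) by apply: openI => //; exact: chart_dom_open.
apply: (@lt_le_trans _ _ (mu B)); last first.
  by apply: le_measure; rewrite ?inE; [exact: open_borel..|exact: subIsetl].
rewrite muE; [|exact: open_borel|exact: subIsetr].
have [crho _] := Srho 0%N.
apply: (@lebint_gt0 _ _ _ (chart i x) (rho (chart i x) / 2)).
- by rewrite divr_gt0// rho0.
(* The sign of [rho] is known only on the chart image; elsewhere the indicator vanishes. *)
- move=> y; rewrite lee_fin indicE.
  case: (boolP (y \in _)) => [/set_mem[z [_ iz] <-]|_]; last by rewrite mulr0.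
  by rewrite mulr1 ltW// rho0//; exists z.
have lt2 : rho (chart i x) / 2 < rho (chart i x).
  by rewrite ltr_pdivrMr// mulr_natr mulr2n ltrDl rho0.
have nrho : \forall y \near chart i x, rho (chart i x) / 2 < rho y.
  exact: (cvgr_gt _ (crho _ iy)).
have nB : \forall y \near chart i x, B (chart_inv i y).
  apply: (chart_inv_continuous iy); rewrite chartK//.
  exact: open_nbhs_nbhs.
(* Membership in the chart image makes [y] the image of its own inverse image, so that [y] lies in
   the image of [B]. *)
have nimg : \forall y \near chart i x, chart_img i y.
  by apply: open_nbhs_nbhs; split=> //; exact: chart_img_open.
near=> y; rewrite lee_fin indicE mem_set ?mulr1.
  by apply/ltW; near: y.
have By : B (chart_inv i y) by near: y.
have [z iz zy] : chart_img i y by near: y.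
by exists z => //; move: By; rewrite -zy chartK.
Unshelve. all: by end_near. Qed.


Lemma continuous_borel (f : M -> R) : continuous f ->
  measurable_fun [set: borel M] (f : borel M -> R).
Proof.
move=> cf; apply: (measurability (measurable_realfun.RGenOpens.G (R:=R))).
  exact: measurable_realfun.RGenOpens.measurableE.
move=> _ [_ [a [b ->]] <-]; rewrite setTI; apply: open_borel.
by apply: open_comp; [move=> ? _; exact: cf|exact: interval_open].
Qed.

Lemma continuous_integrable (f : M -> R) :
  compact [set: M] -> (mu [set: borel M] < +oo)%E -> continuous f ->
  mu.-integrable [set: borel M] (EFin \o f).
Proof.
move=> cM fmu cf; apply: measurable_bounded_integrable => //.
  exact: continuous_borel.
have : bounded_set (f @` [set: M]).
  apply: compact_bounded; apply: continuous_compact => //.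
  exact: continuous_subspaceT.
by move=> [K [Kr Kb]]; exists K; split=> // k /Kb fk x _; apply: fk; exists x.
Qed.

End Measure.

(** * Integration by parts on a compact manifold and the integrated curvature-dimension
    inequality *)

Section CompactIntegral.
Context {R : realType} {M : ptopologicalType} {n : nat} {A : atlas R M n}
  {mu : {measure set (borel M) -> \bar R}}.
Hypotheses (M_compact : compact [set: M])
  (mu_finite : (mu [set: borel M] < +oo)%E).
Implicit Types f g : M -> R.

(** This lets the symmetry and nonpositivity of [L], assumed for compactly supported functions, be
    applied to every smooth function. *)
Lemma smooth_compact f : smooth A f -> smooth_c A f.
Proof.
move=> Sf; split=> //; apply: subclosed_compact M_compact _ => //.
exact: closed_closure.
Qed.

Let integrable_smooth f : smooth A f ->
  mu.-integrable [set: borel M] (EFin \o f).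
Proof. by move=> /smooth_continuous; exact: continuous_integrable. Qed.

Lemma integral_ofD f g : smooth A f -> smooth A g ->
  integral_of mu (fun x => f x + g x) = integral_of mu f + integral_of mu g.
Proof. by move=> Sf Sg; apply: RintegralD => //; exact: integrable_smooth. Qed.

Lemma integral_ofZ (c : R) f : smooth A f ->
  integral_of mu (fun x => c * f x) = c * integral_of mu f.
Proof. by move=> Sf; apply: RintegralZl => //; exact: integrable_smooth. Qed.

Lemma le_integral_of f g : smooth A f -> smooth A g ->
  (forall x, f x <= g x) -> integral_of mu f <= integral_of mu g.
Proof. by move=> Sf Sg fg; apply: le_Rintegral => //; exact: integrable_smooth. Qed.

(** By continuity the square of [f] exceeds half of its value at [x0] on an open set [U], which has
    positive finite measure; the integral is then at least [e] times that measure. *)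
Lemma integral_of_sqr_gt0 f : smooth_measure A mu -> smooth A f ->
  (exists x, f x != 0) -> 0 < integral_of mu (f \* f).
Proof.
move=> muA Sf [x0 fx0].
pose e := f x0 ^+ 2 / 2.
have fx2 : 0 < f x0 ^+ 2 by rewrite lt_neqAle eq_sym sqrf_eq0 fx0 sqr_ge0.
have e0 : 0 < e by rewrite divr_gt0.
have Sff : smooth A (f \* f) by exact: smoothM.
pose U : set (borel M) := [set x | e < (f \* f) x].
have oU : open (U : set M).
  apply: (@open_comp _ _ (f \* f) [set r | e < r]); last exact: open_gt.
  by move=> x _; exact: (smooth_continuous _ Sff).
have mU : measurable U by exact: open_borel.
have Ux : U x0 by rewrite /U/= -expr2 ltr_pdivrMr// mulr_natr mulr2n ltrDl.
have U0 := smooth_measure_gt0 _ _ muA oU Ux.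
have Uoo : (mu U < +oo)%E.
  by apply: le_lt_trans mu_finite; apply: le_measure; rewrite ?inE.
have iU : mu.-integrable [set: borel M] (EFin \o \1_U).
  apply: measurable_bounded_integrable => //.
  exists 1; split=> // r r1 x _ /=; apply: le_trans (ltW r1).
  by rewrite indicE; case: (_ \in _); rewrite ?normr0 ?normr1.
apply: (@lt_le_trans _ _ (\int[mu]_x (e * \1_U x))).
  rewrite RintegralZl// mulr_gt0// /Rintegral integral_indic// setIT.
  by rewrite fine_gt0// U0.
apply: le_Rintegral => //; [|exact: integrable_smooth|].
  have -> : EFin \o (fun x => e * \1_U x) = (fun x => e%:E * (\1_U x)%:E)%E.
    by apply/funext => x; rewrite -EFinM.
  exact: integrableZl.
move=> x _; rewrite indicE; case: (boolP (x \in U)) => [/set_mem/ltW|_].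
  by rewrite mulr1.
by rewrite mulr0 /= -expr2 sqr_ge0.
Qed.

Context {L : (M -> R) -> (M -> R)}.
Hypotheses (L_diffusion : diffusion_operator A L)
  (L1_eq0 : forall x, L (fun=> 1) x = 0)
  (L_symmetric : symmetric_operator A mu L).

Let SL f : smooth A f -> smooth A (L f).
Proof. exact: smooth_diffusion. Qed.

(** Symmetry of [L] is tested against the constant 1, which has compact support here and is
    annihilated by [L]. *)
Lemma integral_diffusion f : smooth A f -> integral_of mu (L f) = 0.
Proof.
move=> Sf; have := L_symmetric _ _ (smooth_compact _ (smooth_cst 1))
                                   (smooth_compact _ Sf).
rewrite (_ : (fun=> 1) \* L f = L f); last by apply/funext => x; rewrite /= mul1r.
move=> ->; rewrite (_ : f \* L _ = fun x => 0 * f x).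
  by rewrite integral_ofZ// mul0r.
by apply/funext => x; rewrite /= L1_eq0 mulr0 mul0r.
Qed.

(** The term [L (f \* g)] integrates to zero, and by symmetry the two remaining terms, each of
    weight one half, have equal integrals. *)
Lemma integral_carre f g : smooth A f -> smooth A g ->
  integral_of mu (carre L f g) = - integral_of mu (f \* L g).
Proof.
move=> Sf Sg; pose h x := - 2^-1 * (f \* L g) x + - 2^-1 * (g \* L f) x.
have SfLg : smooth A (f \* L g) by apply: smoothM => //; exact: SL.
have SgLf : smooth A (g \* L f) by apply: smoothM => //; exact: SL.
have Sfg : smooth A (L (f \* g)) by exact/SL/smoothM.
have -> : carre L f g = fun x => 2^-1 * L (f \* g) x + h x.
  by apply/funext => x; rewrite /carre /h /=; ring.
rewrite integral_ofD ?integral_ofZ ?integral_diffusion//.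
- rewrite mulr0 add0r integral_ofD ?integral_ofZ//; try exact: smoothZ.
  rewrite (L_symmetric g f); [|exact: smooth_compact..].
  by rewrite mulNr -opprD -mulrDl -[2^-1]div1r -splitr mul1r.
- exact: smoothM.
- exact: smoothZ.
- by apply: smoothD; exact: smoothZ.
Qed.

Let iterated_formE (G : (M -> R) -> (M -> R) -> (M -> R)) f :
  iterated_form L G f = fun x => 2^-1 * L (G f f) x + -1 * G f (L f) x.
Proof. by apply/funext => x; rewrite /iterated_form; field. Qed.

Lemma smooth_iterated_form (G : (M -> R) -> (M -> R) -> (M -> R)) f :
  smooth A (G f f) -> smooth A (G f (L f)) -> smooth A (iterated_form L G f).
Proof.
move=> SG SGL; rewrite iterated_formE.
by apply: smoothD; apply: smoothZ => //; exact: SL.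
Qed.

(** The term [L (G f f)] integrates to zero. Leaving [G] general covers both Gamma_2 and
    Gamma_2^Z. *)
Lemma integral_iterated_form (G : (M -> R) -> (M -> R) -> (M -> R)) f :
  smooth A (G f f) -> smooth A (G f (L f)) ->
  integral_of mu (iterated_form L G f) = - integral_of mu (G f (L f)).
Proof.
move=> SG SGL.
rewrite iterated_formE.
rewrite integral_ofD ?integral_ofZ ?integral_diffusion ?mulr0 ?add0r ?mulN1r//.
- exact: SL.
- exact/smoothZ/SL.
- exact: smoothZ.
Qed.

(* Symmetry and [int L g = 0] give [int Gamma_2(f) = int (L f)^2] and
   [int Gamma(f) = - int f L f]. *)
Lemma integral_CD GZ (rho1 rho2 kappa d nu : R) f :
  vertical_form A GZ -> CD A L GZ rho1 rho2 kappa d -> 0 < nu -> smooth A f ->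
  d^-1 * integral_of mu (L f \* L f)
    - (rho1 - kappa / nu) * integral_of mu (f \* L f)
    + rho2 * integral_of mu (GZ f f)
  <= integral_of mu (L f \* L f) - nu * integral_of mu (GZ f (L f)).
Proof.
move=> GZ_form LCD nu0 Sf; have SLf := SL _ Sf.
have SG g h : smooth A g -> smooth A h -> smooth A (carre L g h).
  exact: smooth_carre.
have SZ g h : smooth A g -> smooth A h -> smooth A (GZ g h).
  exact: vform_smooth.
have S1 := smooth_iterated_form (carre L) _ (SG _ _ Sf Sf) (SG _ _ Sf SLf).
have S2 := smooth_iterated_form GZ _ (SZ _ _ Sf Sf) (SZ _ _ Sf SLf).
have SLL := smoothM _ _ SLf SLf.
have SGa := smoothZ (rho1 - kappa / nu) _ (SG _ _ Sf Sf).
have SZa := smoothZ rho2 _ (SZ _ _ Sf Sf).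
have SLa := smoothZ d^-1 _ SLL.
have S2a := smoothZ nu _ S2.
have := le_integral_of _ _ (smoothD _ _ (smoothD _ _ SLa SGa) SZa)
  (smoothD _ _ S1 S2a).
rewrite (integral_ofD _ _ (smoothD _ _ SLa SGa) SZa) (integral_ofD _ _ SLa SGa).
rewrite (integral_ofD _ _ S1 S2a) (integral_ofZ _ _ SLL) (integral_ofZ _ _ S2).
rewrite (integral_ofZ _ _ (SG _ _ Sf Sf)) (integral_ofZ _ _ (SZ _ _ Sf Sf)).
rewrite !integral_iterated_form//; try by [exact: SG|exact: SZ].
rewrite !integral_carre// (L_symmetric f (L f)); [|exact: smooth_compact..].
by rewrite opprK !mulrN; apply=> x; rewrite /= -expr2; exact: LCD.
Qed.

End CompactIntegral.

(** * The lower bound on the first non-zero eigenvalue *)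

Theorem proposition1p6 (R : realType) (M : ptopologicalType) (n : nat)
  (A : atlas R M n) (mu : {measure set (borel M) -> \bar R})
  (L : (M -> R) -> (M -> R)) (GZ : (M -> R) -> (M -> R) -> (M -> R))
  (P : R -> (M -> R) -> (M -> R)) (rho1 rho2 kappa d lam1 : R)
  (M_manifold : connected_manifold_topology M)
  (mu_smooth : smooth_measure A mu)
  (L_diffusion : diffusion_operator A L)
  (L1_eq0 : forall x, L (fun=> 1) x = 0)
  (L_subelliptic : locally_subelliptic A mu L)
  (L_symmetric : symmetric_operator A mu L)
  (L_nonpositive : nonpositive_operator A mu L)
  (M_subunit_connected : subunit_connected A L)
  (M_subunit_complete : subunit_complete A L)
  (GZ_form : vertical_form A GZ)
  (P_heat : heat_semigroup A mu L P)
  (hyp1 : H1 A L GZ) (hyp2 : H2 A L GZ) (hyp3 : H3 A L GZ P)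
  (rho1_gt0 : 0 < rho1) (rho2_gt0 : 0 < rho2) (kappa_ge0 : 0 <= kappa)
  (d_gt0 : 0 < d)
  (L_CD : CD A L GZ rho1 rho2 kappa d)
  (* known consequences of the above (Baudoin-Garofalo) *)
  (M_compact : compact [set: M]) (mu_finite : (mu [set: borel M] < +oo)%E)
  (lam1_first : first_nonzero_eigenvalue_opp A L lam1) :
  rho1 * rho2 / ((d - 1) / d * rho2 + kappa) <= lam1.
Proof.
have [[f [Sf f0 eLf]] lam0 _] := lam1_first.
have {}eLf : L f = fun x => - lam1 * f x.
  by apply/funext => x; rewrite mulNr -eLf opprK.
pose F := integral_of mu (f \* f); pose Z := integral_of mu (GZ f f).
have Sff : smooth A (f \* f) by exact: smoothM.
have F0 : 0 < F by exact: (integral_of_sqr_gt0 M_compact mu_finite).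
have fLf : integral_of mu (f \* L f) = - lam1 * F.
  rewrite -(integral_ofZ M_compact mu_finite _ _ Sff); congr integral_of.
  by apply/funext => x; rewrite eLf /= mulrCA.
have LfLf : integral_of mu (L f \* L f) = lam1 ^+ 2 * F.
  rewrite -(integral_ofZ M_compact mu_finite _ _ Sff); congr integral_of.
  by apply/funext => x; rewrite eLf /= mulrACA mulrNN.
have GZfLf : integral_of mu (GZ f (L f)) = - lam1 * Z.
  have SZ := vform_smooth GZ_form Sf Sf.
  rewrite -(integral_ofZ M_compact mu_finite _ _ SZ); congr integral_of.
  have SLf : smooth A (L f) by exact: smooth_diffusion.
  (* [vform_linear] concerns the first argument, hence the exchange. Homogeneity is its case with
     zero added term, which needs [z0]; and [z0] is its case with all terms zero, where a value
     equals its own double. *)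
  rewrite (vform_sym GZ_form Sf SLf) eLf; apply/funext => x.
  have S0 : smooth A (fun=> 0) by exact: smooth_cst.
  have z0 : GZ (fun=> 0) f x = 0.
    have := vform_linear GZ_form 1 S0 S0 Sf x.
    rewrite (_ : (fun=> 1 * 0 + 0) = (fun=> 0)).
      by rewrite mul1r => /eqP; rewrite -subr_eq0 opprD addrA subrr sub0r
      oppr_eq0 => /eqP.
    by apply/funext => ?; rewrite mulr0 addr0.
  have := vform_linear GZ_form (- lam1) Sf S0 Sf x.
  by rewrite z0 addr0 => <-; congr (GZ _ _ _); apply/funext => ?; rewrite addr0.
have lam_gt0 : 0 < lam1.
  (* Nonpositivity of [L] at [f] reads [- lam1 * F <= 0], and [F > 0]. *)
  have := L_nonpositive _ (smooth_compact M_compact _ Sf).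
  rewrite fLf mulNr oppr_le0 pmulr_lge0// => lam_ge0.
  by rewrite lt_neqAle eq_sym lam0.
have nu0 : 0 < rho2 / lam1 by exact: divr_gt0.
have := integral_CD M_compact mu_finite L_diffusion L1_eq0 L_symmetric
  _ _ _ _ _ _ _ GZ_form L_CD nu0 Sf.
rewrite fLf LfLf GZfLf -/Z => main.
have dE : (d - 1) / d = 1 - d^-1 by rewrite mulrBl divff ?gt_eqF// mul1r.
have key : rho1 * rho2 <= lam1 * ((d - 1) / d * rho2 + kappa).
  rewrite dE -subr_ge0.
  rewrite -subr_ge0 in main.
  (* For the chosen [nu], this product equals the difference of the two sides of [main], the terms
     in [Z] having cancelled. *)
  have : 0 <= (lam1 * F / rho2)
              * (lam1 * ((1 - d^-1) * rho2 + kappa) - rho1 * rho2).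
    by apply: le_trans main _; rewrite le_eqVlt; apply/orP; left; apply/eqP;
      field; rewrite !gt_eqF.
  by rewrite pmulr_rge0// divr_gt0// mulr_gt0.
(* The denominator is not visibly positive, since [d] may be less than 1. Its sign is read off
   [key]: its product with [lam1 > 0] is at least [rho1 * rho2 > 0]. *)
rewrite ler_pdivrMr// -(pmulr_rgt0 _ lam_gt0).
by apply: lt_le_trans key; rewrite mulr_gt0.
Qed.
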